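(* Let $T$ be a fixed tree with $k$ vertices and $d$ a degree bound. There is an absolute constant $\epsilon_0>0$ such that for every $0<\epsilon\le\epsilon_0$ the following holds. Consider the algorithm that, given query access to an $N$-vertex graph $G$ of maximum degree at most $d$, sets $D=k(8d/\epsilon)^{4k+2}$, selects $4/\epsilon$ start vertices uniformly and independently at random from $[N]$, performs from each start vertex $s$ a BFS that stops as soon as $D$ layers are explored (or the connected component of $s$ is exhausted), and accepts if and only if all explored subgraphs are $T$-minor free. If $G$ is $\epsilon$-far from being $T$-minor free, then this algorithm rejects with probability at least $2/3$.
   Context: $G$ has a $T$-minor if $T$ is obtainable from $G$ by vertex deletions, edge deletions and edge contractions. $G=([N],E)$ is $\epsilon$-far from being $T$-minor free if for every $T$-minor free $G'=([N],E')$ the symmetric difference of $E$ and $E'$ has more than $\epsilon dN$ elements. An explored subgraph consists of the vertices and edges discovered by the BFS. *)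

(* Defs.v *)
From mathcomp Require Import all_boot all_order all_algebra.
From mathcomp Require Import boolp reals.
From Stdlib Require Import Relation_Operators.

Set Implicit Arguments.
Unset Strict Implicit.
Unset Printing Implicit Defensive.

Import Order.TTheory GRing.Theory Num.Theory.

(* Finite simple graphs whose vertices form a subset of an ambient finite type;
   edges are unordered pairs. *)
Record sgraph (V : finType) := SGraph {
  vset : {set V};
  eset : {set {set V}};
  esetP : [forall e in eset, (#|e| == 2) && (e \subset vset)] }.

Definition adj (V : finType) (G : sgraph V) : rel V :=
  fun x y => [set x; y] \in eset G.

Definition max_degree_le (V : finType) (G : sgraph V) (d : nat) : Prop :=
  forall v : V, #|[set e in eset G | v \in e]| <= d.

Definition is_tree (V : finType) (G : sgraph V) : Prop :=
  [/\ vset G != set0,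
      {in vset G &, forall x y, connect (adj G) x y}
    & forall c : seq V, 2 < size c -> ~ ucycle (adj G) c].

Definition isomorphic (V W : finType) (G : sgraph V) (H : sgraph W) : Prop :=
  exists f : V -> W,
    [/\ {in vset G &, injective f},
        f @: vset G = vset H
      & [set f @: e | e : {set V} in eset G] = eset H].

Definition merge_into (V : finType) (u v : V) : V -> V :=
  fun x => if x == v then u else x.

(* In a contraction of the edge uv the merged vertex keeps the name u; the loop
   is dropped by the cardinality condition, and parallel edges are identified
   because the image is a set. *)
Inductive minor_step (V : finType) (G H : sgraph V) : Prop :=
| DeleteVertex v of
    v \in vset G & vset H = vset G :\ v
    & eset H = [set e in eset G | v \notin e]
| DeleteEdge e of
    e \in eset G & vset H = vset G & eset H = eset G :\ e
| ContractEdge u v of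
    [set u; v] \in eset G & vset H = vset G :\ v
    & eset H = [set e in [set merge_into u v @: e' | e' : {set V} in eset G]
                  | #|e| == 2].

Definition has_minor (W V : finType) (T : sgraph W) (G : sgraph V) : Prop :=
  exists2 H : sgraph V,
    clos_refl_trans (sgraph V) (@minor_step V) G H & isomorphic H T.

Definition minor_free (W V : finType) (T : sgraph W) (G : sgraph V) : Prop :=
  ~ has_minor T G.

Definition edge_symdiff (V : finType) (G H : sgraph V) : {set {set V}} :=
  (eset G :\: eset H) :|: (eset H :\: eset G).

Definition far_from_minor_free (R : realType) (W : finType) (T : sgraph W)
    (d : nat) (eps : R) (N : nat) (G : sgraph 'I_N) : Prop :=
  forall G' : sgraph 'I_N, vset G' = [set: 'I_N] -> minor_free T G' ->
    (eps * d%:R * N%:R < #|edge_symdiff G G'|%:R)%R.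

(* [n] is the number of layers still to be explored and [layer] the current
   layer.  Exploring a layer discovers all edges incident to it, together with
   their endpoints; the search stops early once the component is exhausted.
   The result consists of the vertices and the edges discovered. *)
Fixpoint bfs (V : finType) (G : sgraph V) (n : nat) (seen layer : {set V})
    (found : {set {set V}}) : {set V} * {set {set V}} :=
  if n is n'.+1 then
    if layer == set0 then (seen, found) else
    let next := [set y | [exists x in layer, adj G x y]] :\: seen in
    bfs G n' (seen :|: next) next
      (found :|: [set e in eset G | ~~ [disjoint e & layer]])
  else (seen, found).

Definition bfs_from (V : finType) (G : sgraph V) (D : nat) (s : V) :=
  bfs G D [set s] [set s] set0.

Lemma bfs_wf (V : finType) (G : sgraph V) n (seen layer : {set V})
    (found : {set {set V}}) :
  layer \subset seen ->
  [forall e in found, (#|e| == 2) && (e \subset seen)] ->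
  [forall e in (bfs G n seen layer found).2,
     (#|e| == 2) && (e \subset (bfs G n seen layer found).1)].
Proof.
elim: n seen layer found => [|n IHn] seen layer found //= sLS wf.
case: ifP => // _; apply: IHn; first exact: subsetUr.
apply/forall_inP => e; rewrite inE => /orP[/(forall_inP wf)/andP[-> sub] /=|].
  exact: subset_trans sub (subsetUl _ _).
rewrite inE => /andP[eG]; have /andP[e2 _] := forall_inP (esetP G) e eG.
rewrite e2 /= => /pred0Pn[x /andP[/= xe xL]].
apply/subsetP => z ze; rewrite !inE.
case: (boolP (z \in seen)) => //= zS.
have xz : x != z by apply: contraNneq zS => <-; apply: subsetP xL.
apply/exists_inP; exists x => //; rewrite /adj.
suff -> : [set x; z] = e by [].
apply/eqP; rewrite eqEcard (eqP e2) cards2 xz andbT.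
by apply/subsetP => y; rewrite !inE => /orP[] /eqP->.
Qed.

Lemma bfs_from_wf (V : finType) (G : sgraph V) (D : nat) (s : V) :
  [forall e in (bfs_from G D s).2,
     (#|e| == 2) && (e \subset (bfs_from G D s).1)].
Proof. by apply: bfs_wf => //; apply/forall_inP => e; rewrite inE. Qed.

Definition explored_subgraph (V : finType) (G : sgraph V) (D : nat) (s : V) :
    sgraph V :=
  SGraph (bfs_from_wf G D s).

Definition ceil_nat (R : realType) (x : R) : nat := `|Num.ceil x|%N.

Definition bfs_depth (R : realType) (k d : nat) (eps : R) : nat :=
  ceil_nat (k%:R * (8 * d%:R / eps) ^+ (4 * k + 2))%R.

Definition num_starts (R : realType) (eps : R) : nat := ceil_nat (4 / eps)%R.

Definition tester_accepts (W : finType) (T : sgraph W) (D m N : nat)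
    (G : sgraph 'I_N) (start : {ffun 'I_m -> 'I_N}) : Prop :=
  forall i : 'I_m, minor_free T (explored_subgraph G D (start i)).

(* Probability of an event under the uniform distribution on a finite type; on
   {ffun 'I_m -> 'I_N} this is the law of m independent uniform elements
   of 'I_N. *)
Definition uniform_Pr (R : realType) (Omega : finType) (P : Omega -> Prop) : R :=
  (#|[set w | `[< P w >]]|%:R / #|Omega|%:R)%R.

(* Main.v *)
(* A vertex [s] is a witness when its explored subgraph has a T-minor; by
   Bernoulli's inequality it suffices that more than eps N / 2 vertices are
   witnesses.  Otherwise cut the graph into clusters, one at a time: a witness is
   isolated at the cost of d edges, and for any other [s] some ball around [s] in
   the remaining graph, of radius less than D, has at most (eps / 2) d edges per
   vertex leaving it.  The clusters are T-minor free and T is connected, so at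
   most eps d N edge deletions make the graph T-minor free.

   The sparse ball exists because balls grow exponentially as long as they are
   not sparse, whereas T-minor free balls of bounded degree grow polynomially: a
   BFS tree of depth r and degree d with more than ((d + 1)(r + 1))^j vertices
   contracts onto the complete binary tree of height j, and this contains every
   tree with at most j + 1 vertices as a rooted minor. *)

Require Import Defs.
From mathcomp Require Import all_boot all_order all_algebra.
From mathcomp Require Import boolp reals zify ring lra.
From Stdlib Require Import Relation_Operators.

Set Implicit Arguments.
Unset Strict Implicit.
Unset Printing Implicit Defensive.

Import Order.TTheory GRing.Theory Num.Theory.

(** * Subgraphs, minors and unions of components *)

Section Graphs.
Variable V : finType.
Implicit Types (G H : sgraph V) (A B : {set V}) (x y : V).

Lemma sgraph_eq G H : vset G = vset H -> eset G = eset H -> G = H.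
Proof.
case: G => vG eG pG; case: H => vH eH pH /= eqv eqe; subst vH eH.
by rewrite (bool_irrelevance pG pH).
Qed.

Lemma eset_wf G e : e \in eset G -> #|e| = 2 /\ e \subset vset G.
Proof. by move=> /(forall_inP (esetP G))/andP[/eqP]. Qed.

Lemma esetE G e : e \in eset G -> exists x y, e = [set x; y] /\ x != y.
Proof.
by move=> /eset_wf[/eqP/cards2P[x [y [xy ->]]] _]; exists x, y.
Qed.

Lemma adjC G x y : adj G x y = adj G y x.
Proof. by rewrite /adj setUC. Qed.

Lemma adj_neq G x y : adj G x y -> x != y.
Proof. by move=> /eset_wf[+ _]; rewrite cards2; case: eqP. Qed.

Lemma adj_vsetl G x y : adj G x y -> x \in vset G.
Proof. by move=> /eset_wf[_ /subsetP]; apply; rewrite !inE eqxx. Qed.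

Lemma adj_vsetr G x y : adj G x y -> y \in vset G.
Proof. by rewrite adjC; apply: adj_vsetl. Qed.

Lemma mkgraph_wf (vs : {set V}) (es : {set {set V}}) :
  [forall e in [set e in es | (#|e| == 2) && (e \subset vs)],
     (#|e| == 2) && (e \subset vs)].
Proof. by apply/forall_inP => e; rewrite inE => /andP[]. Qed.

(** Members of [es] that are not pairs of elements of [vs] are dropped, so any two sets define a
    graph. *)
Definition mkgraph vs es : sgraph V := SGraph (mkgraph_wf vs es).

Definition induced G A : sgraph V := mkgraph (vset G :&: A) (eset G).

Lemma eset_mkgraph (vs : {set V}) (es : {set {set V}}) :
  (forall e, e \in es -> #|e| = 2 /\ e \subset vs) -> eset (mkgraph vs es) = es.
Proof.
move=> wf; apply/setP => e; rewrite inE.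
by case: (boolP (e \in es)) => // /wf[-> ->].
Qed.

Lemma eset_induced G A e :
  (e \in eset (induced G A)) = (e \in eset G) && (e \subset A).
Proof.
rewrite inE subsetI; case: (boolP (e \in eset G)) => //= /eset_wf[-> ->].
by [].
Qed.

Lemma adj_induced G A x y :
  adj (induced G A) x y = [&& adj G x y, x \in A & y \in A].
Proof.
rewrite /adj eset_induced; congr andb.
apply/subsetP/andP => [sub|[xA yA] z].
  by split; apply: sub; rewrite !inE eqxx ?orbT.
by rewrite !inE => /orP[] /eqP->.
Qed.

Local Notation minors := (clos_refl_trans (sgraph V) (@minor_step V)).

(** Induction on the number of surplus edges and vertices. Edges are deleted first, so that a
    surplus vertex is isolated when its turn comes. *)
Lemma subgraph_minors G H :
  vset H \subset vset G -> eset H \subset eset G -> minors G H.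
Proof.
have [n] := ubnP (#|eset G :\: eset H| + #|vset G :\: vset H|).
elim: n G => // n IHn G; rewrite ltnS => ltn sv se.
have [|/set0Pn[e]] := eqVneq (eset G :\: eset H) set0.
  move=> /eqP; rewrite setD_eq0 => se'.
  have eqe : eset G = eset H by apply/eqP; rewrite eqEsubset se' se.
  have [|/set0Pn[v]] := eqVneq (vset G :\: vset H) set0.
    move=> /eqP; rewrite setD_eq0 => sv'.
    have eqv : vset G = vset H by apply/eqP; rewrite eqEsubset sv' sv.
    by rewrite (sgraph_eq eqv eqe); apply: rt_refl.
  rewrite inE => /andP[vH vG].
  have eqG : eset (mkgraph (vset G :\ v) (eset G)) = eset G.
    apply: eset_mkgraph => e eG; have [-> sG] := eset_wf eG; split=> //.
    rewrite subsetD1 sG /=; apply: contra vH.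
    by rewrite eqe in eG; have [_ /subsetP] := eset_wf eG; apply.
  apply: rt_trans (IHn (mkgraph (vset G :\ v) (eset G)) _ _ _).
  - apply: rt_step; apply: (DeleteVertex (v := v)) => //.
    rewrite eqG; apply/setP => e; rewrite inE.
    case: (boolP (e \in eset G)) => //= eG; apply/esym.
    apply: contra vH => ve; rewrite eqe in eG.
    by have [_ /subsetP] := eset_wf eG; apply.
  - rewrite eqG; apply: leq_trans ltn; rewrite ltn_add2l /=.
    apply: proper_card; apply/properP; split.
      by apply: setSD; apply: subsetDl.
    by exists v; rewrite !inE ?vG ?vH // eqxx andbF.
  - by rewrite /= subsetD1 sv.
  - by rewrite eqG.
rewrite inE => /andP[eH eG].
have eqG : eset (mkgraph (vset G) (eset G :\ e)) = eset G :\ e.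
  by apply: eset_mkgraph => e'; rewrite inE => /andP[_ /eset_wf].
apply: rt_trans (IHn (mkgraph (vset G) (eset G :\ e)) _ _ _).
- by apply: rt_step; apply: (DeleteEdge (e := e)).
- rewrite eqG; apply: leq_trans ltn; rewrite ltn_add2r /=.
  apply: proper_card; apply/properP; split.
    by apply: setSD; apply: subsetDl.
  by exists e; rewrite !inE ?eG ?eH // eqxx andbF.
- by [].
- by rewrite eqG subsetD1 se.
Qed.

Lemma subgraph_has_minor (W : finType) (T : sgraph W) G H :
  vset H \subset vset G -> eset H \subset eset G ->
  has_minor T H -> has_minor T G.
Proof.
move=> sv se [K HK iso]; exists K => //.
exact: rt_trans (subgraph_minors sv se) HK.
Qed.

Lemma card_minors G H : minors G H -> #|vset H| <= #|vset G|.
Proof.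
elim=> {G H} [G H|G|G H K _ le1 _ le2] //; last exact: leq_trans le2 le1.
by case=> [v _ -> _|e _ -> _|u v _ -> _] //; apply: subset_leq_card; apply: subsetDl.
Qed.

Lemma has_minor_card (W : finType) (T : sgraph W) G :
  has_minor T G -> #|vset T| <= #|vset G|.
Proof.
move=> [H /card_minors le [f [_ <- _]]].
exact: leq_trans (leq_imset_card _ _) le.
Qed.

(** As far as vertices of [G] are concerned, [A] is a union of connected components; elements of [V]
    outside the graph may lie on either side. *)
Definition separated G A :=
  forall x y, adj G x y -> (x \in A) = (y \in A).

Lemma separated_edge G A e : separated G A -> e \in eset G ->
  (e \subset A) || (e \subset ~: A).
Proof.
move=> sep eG; have [x [y [def_e _]]] := esetE eG.
have := sep x y; rewrite /adj -def_e eG => /(_ isT) xy.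
rewrite def_e !subUset !sub1set !inE -xy.
by case: (x \in A).
Qed.

Lemma mergeE (u v x : V) : merge_into u v x = if x == v then u else x.
Proof. by []. Qed.

Lemma separatedP G A : (forall e, e \in eset G -> (e \subset A) || (e \subset ~: A)) ->
  separated G A.
Proof.
move=> sep x y /sep; rewrite !subUset !sub1set !inE.
by case: (x \in A); case: (y \in A).
Qed.

Lemma merge_edge G u v x y :
  adj G x y -> merge_into u v x != merge_into u v y ->
  [set merge_into u v x; merge_into u v y] \in
    [set e in [set merge_into u v @: e' | e' : {set V} in eset G] | #|e| == 2].
Proof.
move=> xy neq; rewrite inE cards2 neq andbT.
by apply/imsetP; exists [set x; y] => //; rewrite imsetU1 imset_set1.
Qed.

Lemma contract_edge G H u v :
  eset H = [set e in [set merge_into u v @: e' | e' : {set V} in eset G]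
              | #|e| == 2] ->
  forall e, e \in eset H -> exists x y,
    [/\ adj G x y, merge_into u v x != merge_into u v y
      & e = [set merge_into u v x; merge_into u v y]].
Proof.
move=> -> e; rewrite inE => /andP[/imsetP[e' e'G ->]].
have [x [y [def_e _]]] := esetE e'G; rewrite def_e imsetU1 imset_set1 cards2.
move=> neq; exists x, y; split=> //; first by rewrite /adj -def_e.
by rewrite eqSS eqb1 in neq.
Qed.

Lemma separated_step G H A : minor_step G H -> separated G A -> separated H A.
Proof.
move=> st sep; apply: separatedP => e.
case: st => [v vG vH eH|e0 e0G vH eH|u v uvG vH eH].
- by rewrite eH inE => /andP[eG _]; apply: separated_edge sep eG.
- by rewrite eH inE => /andP[_ eG]; apply: separated_edge sep eG.
move=> /(contract_edge eH)[x [y [xy _ ->]]].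
have uv := sep _ _ uvG; rewrite !subUset !sub1set !inE !mergeE.
have {}xy := sep _ _ xy.
case: eqP => [ex|_]; case: eqP => [ey|_]; move: uv xy;
  rewrite ?ex ?ey; by case: (u \in A) (v \in A) (x \in A) (y \in A) => [] [] [] [].
Qed.

(** A deletion leaves a subgraph on each side. A contracted edge has both ends on one side: outside
    [A] it does not affect the induced graph, inside [A] the same contraction is performed there. *)
Lemma induced_step G H A : minor_step G H -> separated G A ->
  minors (induced G A) (induced H A).
Proof.
move=> st sep.
case: st => [v vG vH eH|e0 e0G vH eH|u v uvG vH eH].
- apply: subgraph_minors; first by apply: setSI; rewrite vH subsetDl.
  apply/subsetP => e; rewrite !eset_induced eH inE.
  by move=> /andP[/andP[-> _] ->].
- apply: subgraph_minors; first by apply: setSI; rewrite vH.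
  apply/subsetP => e; rewrite !eset_induced eH inE.
  by move=> /andP[/andP[_ ->] ->].
have uv : u != v := adj_neq uvG.
have [uA|uA] := boolP (u \in A); last first.
  have vA : v \notin A by rewrite -(sep u v).
  suff -> : induced H A = induced G A by apply: rt_refl.
  apply: sgraph_eq.
    apply/setP => x; rewrite /= !inE vH !inE.
    by have [->|] := eqVneq x v => //; rewrite (negPf vA) !andbF.
  apply/setP => e; rewrite !eset_induced; apply/andP/andP => -[eE eA]; split=> //.
    have [x [y [xy _ def_e]]] := contract_edge eH eE.
    move: eA; rewrite def_e subUset !sub1set !mergeE.
    case: eqP => _; case: eqP => _; rewrite ?(negPf uA) ?andbF // => _; exact: xy.
  have [x [y [def_e xy]]] := esetE eE.
  have nv z : z \in e -> merge_into u v z = z.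
    rewrite mergeE; case: eqP => // -> /(subsetP eA).
    by rewrite (negPf vA).
  have adxy : adj G x y by rewrite /adj -def_e.
  have := merge_edge (u := u) (v := v) adxy.
  rewrite eH def_e !nv ?def_e ?inE ?eqxx ?orbT //; exact.
have vA : v \in A by rewrite -(sep u v).
apply: rt_step; apply: (ContractEdge (u := u) (v := v)).
- by rewrite eset_induced uvG subUset !sub1set uA vA.
- by rewrite /= vH setIDAC.
apply/setP => e; rewrite eset_induced; apply/andP/idP => [[eE eA]|].
  have [x [y [xy neq def_e]]] := contract_edge eH eE.
  rewrite def_e; apply: merge_edge => //; rewrite adj_induced xy /=.
  move: eA; rewrite def_e subUset !sub1set !mergeE.
  by case: eqP => [->|_]; case: eqP => [->|_]; rewrite ?vA // => /andP[xA yA];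
    rewrite ?xA ?yA.
rewrite inE => /andP[/imsetP[e' + ->]]; rewrite eset_induced => /andP[e'G e'A] c2.
split; first by rewrite eH inE c2 andbT; apply: imset_f.
apply/subsetP => z /imsetP[z' /(subsetP e'A) z'A ->]; rewrite mergeE.
by case: eqP.
Qed.

Lemma induced_minors G H A : minors G H -> separated G A ->
  separated H A /\ minors (induced G A) (induced H A).
Proof.
elim=> {G H} [G H st|G|G H K _ IH1 _ IH2] sep.
- by split; [apply: separated_step sep|apply: induced_step].
- by split=> //; apply: rt_refl.
by have [/IH2[sepK m2] m1] := IH1 sep; split=> //; apply: rt_trans m2.
Qed.

Lemma separatedC G A : separated G A -> separated G (~: A).
Proof. by move=> sep x y /sep; rewrite !inE => ->. Qed.

Lemma induced_id G A : vset G \subset A -> induced G A = G.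
Proof.
move=> sub; apply: sgraph_eq; first exact/setIidPl.
apply/setP => e; rewrite eset_induced; case: (boolP (e \in _)) => //=.
by move=> /eset_wf[_ sv]; apply: subset_trans sub.
Qed.

End Graphs.

(** Minor steps restrict to both sides of the cut, and the final copy of [T], being connected, lies
    on one side. *)
Lemma separated_has_minor (V W : finType) (T : sgraph W) (G : sgraph V) (A : {set V}) :
  {in vset T &, forall a b, connect (adj T) a b} -> separated G A ->
  has_minor T G ->
  has_minor T (induced G A) \/ has_minor T (induced G (~: A)).
Proof.
move=> conT sep [H GH iso].
have [sepH mA] := induced_minors GH sep.
have [_ mCA] := induced_minors GH (separatedC sep).
have [f [injf imf edgf]] := iso.
(* A path of [T] is pulled back to [H] edge by edge, and no edge of [H] changes sides. *)
have conH x y : x \in vset H -> y \in vset H -> (x \in A) = (y \in A).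
  move=> xH yH.
  have /connectP[p] : connect (adj T) (f x) (f y).
    by apply: conT; rewrite -imf imset_f.
  elim: p x xH => [|w p IHp] x xH /=; first by move=> _ /injf->.
  move=> /andP[aw pw] lst.
  have := aw; rewrite /adj -edgf => /imsetP[e eH def_e].
  have [a [b [ab neq]]] := esetE eH; rewrite ab imsetU1 imset_set1 in def_e.
  have adab : adj H a b by rewrite /adj -ab.
  have aH := adj_vsetl adab; have bH := adj_vsetr adab.
  have sepab := sepH _ _ adab.
  have := adj_neq aw => nxw.
  have : f x \in [set f a; f b] by rewrite -def_e !inE eqxx.
  have : w \in [set f a; f b] by rewrite -def_e !inE eqxx orbT.
  rewrite !inE => /orP[]/eqP ew /orP[]/eqP ex; move: nxw; rewrite ex ew ?eqxx //.
    by move=> _; rewrite (injf _ _ xH bH ex) -sepab; apply: IHp => //; rewrite -ew.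
  by move=> _; rewrite (injf _ _ xH aH ex) sepab; apply: IHp => //; rewrite -ew.
have [/subsetP sA|/subsetPn[x xH xA]] := boolP (vset H \subset A).
  by left; exists H => //; rewrite -{1}(induced_id (introT subsetP sA)).
right; exists H => //.
suff sA : vset H \subset ~: A by rewrite -{1}(induced_id sA).
by apply/subsetP => y yH; rewrite inE (conH y x).
Qed.

(** * Minors from branch sets *)

Section MinorModels.
Variables (V W : finType) (T : sgraph W).
Implicit Types (G : sgraph V) (phi : V -> option W).

(** Vertices sent to [None] are related too, but a path that starts in a branch set never leaves
    it. *)
Definition fiber_adj G phi : rel V := fun x y => adj G x y && (phi x == phi y).

(* The branch set of [w] is the fiber of [phi] over [Some w]; [phi] is [None]
   off the branch sets. *)
Record minor_model G (S : {set V}) (A : {set W}) phi : Prop := MinorModel {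
  mm_dom : forall x w, phi x = Some w -> x \in S /\ w \in A;
  mm_onto : forall w, w \in A -> exists x, phi x = Some w;
  mm_conn : forall x y w, phi x = Some w -> phi y = Some w ->
    connect (fiber_adj G phi) x y;
  mm_edge : forall a b, a \in A -> b \in A -> adj T a b ->
    exists x y, [/\ phi x = Some a, phi y = Some b & adj G x y] }.

(** When branch sets are singletons, their vertices and the edges lying over edges of [T] form a
    subgraph isomorphic to [T]. *)
Lemma injective_model_minor G phi : vset T != set0 ->
  minor_model G (vset G) (vset T) phi ->
  (forall x y w, phi x = Some w -> phi y = Some w -> x = y) -> has_minor T G.
Proof.
move=> /set0Pn[w0 _] [dom onto _ edge] inj.
(* [w0] only fills in for vertices outside [vs]. *)
pose f x := odflt w0 (phi x).
pose vs := [set x | phi x].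
pose es := [set e in eset G | (e \subset vs) && (f @: e \in eset T)].
have inH e : (e \in eset (mkgraph vs es)) = (e \in es).
  rewrite inE; case: (boolP (e \in es)) => //=; rewrite inE.
  by move=> /and3P[/eset_wf[-> _] -> _].
exists (mkgraph vs es).
  apply: subgraph_minors; apply/subsetP => /=.
    by move=> x; rewrite inE; case def_x: (phi x) => // _; have [] := dom _ _ def_x.
  by move=> e; rewrite inH inE => /andP[].
exists f; split.
- move=> x y; rewrite !inE /f.
  case dx: (phi x) => [a|] // _; case dy: (phi y) => [b|] //= _ eqab.
  by apply: inj dx _; rewrite eqab.
- apply/setP => w; apply/imsetP/idP => [[x]|/onto[x dx]].
    by rewrite inE /f; case dx: (phi x) => [a|] // _ ->; have [] := dom _ _ dx.
  by exists x; rewrite ?inE /f dx.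
apply/setP => e; apply/imsetP/idP => [[e']|eT].
  by rewrite inH inE => /and3P[_ _ +] ->.
have [a [b [def_e _]]] := esetE eT.
have adab : adj T a b by rewrite /adj -def_e.
have [x [y [dx dy xy]]] := edge _ _ (adj_vsetl adab) (adj_vsetr adab) adab.
have def_f : e = f @: [set x; y] by rewrite imsetU1 imset_set1 /f dx dy.
exists [set x; y] => //; rewrite inH inE -def_f eT andbT.
by rewrite [_ \in _]xy subUset !sub1set !inE dx dy.
Qed.

(** The vertex [u] inherits the edges of [v], so the common branch set loses [v] but stays connected
    and keeps its edges to the other branch sets. *)
Lemma contract_model G H phi u v w : adj G u v ->
  phi u = Some w -> phi v = Some w ->
  vset H = vset G :\ v ->
  eset H = [set e in [set merge_into u v @: e' | e' : {set V} in eset G]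
              | #|e| == 2] ->
  minor_model G (vset G) (vset T) phi ->
  minor_model H (vset H) (vset T) (fun x => if x == v then None else phi x).
Proof.
move=> uv du dv vH eH [dom onto conn edge]; set psi := fun x => _.
have nuv := adj_neq uv.
(* Merging respects branch sets, so paths and edges are carried over by applying
   [merge_into u v]. *)
have psiE x : psi (merge_into u v x) = phi x.
  rewrite /psi mergeE; case: (eqVneq x v) => [->|/negPf->] //.
  by rewrite (negPf nuv) du dv.
have psiS x a : psi x = Some a -> [/\ x != v, phi x = Some a & merge_into u v x = x].
  by rewrite /psi mergeE; case: (eqVneq x v).
have adjH x y : adj G x y -> merge_into u v x != merge_into u v y ->
    adj H (merge_into u v x) (merge_into u v y).
  by move=> xy neq; rewrite /adj eH; apply: merge_edge.
split.
- by move=> x a /psiS[xv /dom[xG aT] _]; rewrite vH !inE xv.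
- by move=> a /onto[x dx]; exists (merge_into u v x); rewrite psiE.
- move=> x y a /psiS[xv dx mx] /psiS[yv dy my].
  rewrite -mx -my; have /connectP[p pth ->] := conn _ _ _ dx dy.
  elim: p x pth {dx mx xv} => [|z p IHp] x //= /andP[/andP[xz /eqP eqf] /IHp].
  apply: connect_trans.
  have [->|neq] := eqVneq (merge_into u v x) (merge_into u v z); first exact: connect0.
  by apply: connect1; rewrite /fiber_adj !psiE eqf eqxx adjH.
move=> a b aT bT ab; have [x [y [dx dy xy]]] := edge _ _ aT bT ab.
exists (merge_into u v x), (merge_into u v y); rewrite !psiE; split=> //.
apply: adjH => //; apply/eqP => eqm.
by have := adj_neq ab; rewrite -[a == b]/(Some a == Some b) -dx -dy -!psiE eqm eqxx.
Qed.

(** Edges inside branch sets are contracted, one at a time. When none is left, connectedness forces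
    every branch set to be a singleton. *)
Lemma model_has_minor G phi : vset T != set0 ->
  minor_model G (vset G) (vset T) phi -> has_minor T G.
Proof.
move=> T0; have [n] := ubnP #|vset G|.
elim: n G phi => // n IHn G phi; rewrite ltnS => leGn mod.
have [|/existsPn noE] := boolP [exists x, exists y,
    [&& adj G x y, phi x == phi y & phi x != None]].
  move=> /existsP[u /existsP[v /and3P[uv /eqP du]]].
  case dv: (phi u) => [w|] // _; rewrite dv in du.
  set es := [set e in [set merge_into u v @: e' | e' : {set V} in eset G]
              | #|e| == 2].
  pose H := mkgraph (vset G :\ v) es.
  have eH : eset H = es.
    apply: eset_mkgraph => e; rewrite inE => /andP[/imsetP[e' e'G ->] /eqP->].
    split=> //; apply/subsetP => z /imsetP[z' z'e ->]; rewrite mergeE !inE.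
    have [_ /subsetP sub] := eset_wf e'G.
    have [_|->] := eqVneq z' v; last by rewrite sub.
    by rewrite (adj_neq uv) (adj_vsetl uv).
  have [K HK iso] : has_minor T H.
    apply: IHn (contract_model uv dv (esym du) _ eH mod) => //.
    by apply: leq_trans leGn; rewrite [in X in _ < X](cardsD1 v) (adj_vsetr uv).
  exists K => //; apply: rt_trans HK; apply: rt_step.
  exact: (ContractEdge (u := u) (v := v)).
apply: (injective_model_minor _ mod) => // x y w dx dy.
have /connectP[p pth ->] := mm_conn mod dx dy.
case: p pth => //= z p /andP[/andP[xz eqf] _].
have := noE x; rewrite negb_exists => /forallP/(_ z).
by rewrite xz eqf dx.
Qed.

End MinorModels.

(** * Trees built by joining two rooted trees along an edge *)

Section RootedTrees.
Variables (W : finType) (T : sgraph W).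
Implicit Types (A B : {set W}) (a b c t : W).

(** A tree is split at one edge [tc] below its root: [A] keeps the root [t], and [B] hangs from the
    child [c]. A binary split is what a fork of a binary tree can host. *)
Inductive rooted_tree : {set W} -> W -> Prop :=
| RootedLeaf t : rooted_tree [set t] t
| RootedJoin A B t c of
    rooted_tree A t & rooted_tree B c & [disjoint A & B] & adj T t c
    & (forall a b, a \in A -> b \in B -> adj T a b -> a = t /\ b = c)
  : rooted_tree (A :|: B) t.

Lemma rooted_tree_root A t : rooted_tree A t -> t \in A.
Proof. by elim=> *; rewrite !inE ?eqxx //; apply/orP; left. Qed.

Lemma connect_inducedC A a b :
  connect (adj (induced T A)) a b = connect (adj (induced T A)) b a.
Proof. by apply: sym_connect_sym => ? ?; rewrite adjC. Qed.

Lemma connect_induced_sub A a b :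
  a \in A -> connect (adj (induced T A)) a b -> b \in A.
Proof.
move=> aA /connectP[p pth ->]; elim: p a aA pth => //= z p IHp a aA.
by move=> /andP[+ /IHp]; rewrite adj_induced => /and3P[_ _ zA]; apply.
Qed.

(** Take a neighbour [c] of [t] in [A] and let [B] be the component of [c] in [A] without [t]. Both
    [B] and [A :\: B] are smaller and connected, and an edge between them must start at [t];
    acyclicity allows only one. *)
Lemma connected_rooted_tree A t :
  (forall c : seq W, 2 < size c -> ~ ucycle (adj T) c) ->
  t \in A -> {in A, forall a, connect (adj (induced T A)) t a} ->
  rooted_tree A t.
Proof.
move=> acyc; have [n] := ubnP #|A|.
elim: n A t => // n IHn A t; rewrite ltnS => leAn tA conA.
have [->|neqA] := eqVneq A [set t]; first exact: RootedLeaf.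
have [a aA neq_a] : exists2 a, a \in A & a != t.
  apply/exists_inP; apply: contraNT neqA => /exists_inPn noa.
  apply/eqP/setP => a; rewrite inE; apply/idP/eqP => [|-> //].
  by move=> /noa/negPn/eqP.
have [c tc cA] : exists2 c, adj T t c & c \in A.
  have /connectP[[|c p] /= pth def_a] := conA a aA.
    by rewrite def_a eqxx in neq_a.
  by move: pth; rewrite adj_induced => /andP[/and3P[tc _ cA] _]; exists c.
pose B := [set b | connect (adj (induced T (A :\ t))) c b].
have cAt : c \in A :\ t by rewrite !inE cA eq_sym (adj_neq tc).
have cB : c \in B by rewrite inE connect0.
have sBAt : B \subset A :\ t.
  by apply/subsetP => b; rewrite inE => /(connect_induced_sub cAt).
have sBA : B \subset A := subset_trans sBAt (subsetDl _ _).
have tB : t \notin B by apply/negP => /(subsetP sBAt); rewrite !inE eqxx.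
have tAB : t \in A :\: B by rewrite inE tB.
have closeB a' b : a' \in A :\: B -> b \in B -> adj T a' b -> a' = t.
  rewrite inE => /andP[a'B a'A] bB ab; apply/eqP; apply: contraNT a'B => nt.
  have := bB; rewrite !inE => cb; apply: connect_trans cb _; apply: connect1.
  by rewrite adj_induced adjC ab (subsetP sBAt) // !inE nt.
rewrite -(setID A B) setUC; have /setIidPr-> := sBA.
apply: (RootedJoin (c := c)) => //.
- apply: IHn => //.
    apply: leq_trans leAn; apply: proper_card; apply/properP.
    by split; [apply: subsetDl|exists c; rewrite // inE cB].
  (* A path to [t] is cut at its first visit to [t]; before that it cannot enter [B], since only [t]
     has neighbours there. *)
  move=> a' a'AB; rewrite connect_inducedC.
  have : connect (adj (induced T A)) a' t.
    by rewrite connect_inducedC; apply: conA; move: a'AB; rewrite inE => /andP[].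
  move=> /connectP[p]; elim: p a' a'AB => [|z p IHp] a' a'AB /=.
    by move=> _ ->; apply: connect0.
  move=> /andP[az pth] lst; have [->|nt] := eqVneq a' t; first exact: connect0.
  move: az; rewrite adj_induced => /and3P[az a'A zA].
  have zAB : z \in A :\: B.
    rewrite inE zA andbT; apply: contra nt => zB.
    by rewrite (closeB a' z).
  apply: connect_trans (IHp z zAB pth lst); apply: connect1.
  by rewrite adj_induced az a'AB zAB.
- apply: IHn => //.
    apply: leq_trans leAn; apply: proper_card; apply/properP.
    by split=> //; exists t.
  move=> b; rewrite inE => /connectP[p + ->].
  move: (c) cB; elim: p => [|z p IHp] c' c'B /=; first by rewrite connect0.
  move=> /andP[c'z /IHp IH].
  have zB : z \in B.
    by have := c'B; rewrite !inE => h; apply: connect_trans h (connect1 c'z).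
  apply: connect_trans (IH zB); apply: connect1.
  by move: c'z; rewrite !adj_induced => /and3P[-> _ _]; rewrite c'B zB.
- by rewrite -setI_eq0 setIDAC setDE -setIA setICr setI0.
move=> a' b a'AB bB ab; have eqt := closeB _ _ a'AB bB ab; split=> //.
rewrite {}eqt {a' a'AB} in ab.
(* If [b] differs from [c], a simple path from [c] to [b] that avoids [t] closes through [t] to a
   cycle with at least three vertices. *)
have := bB; rewrite inE => /connectP[p pth def_b].
move: def_b; case/shortenP: pth => p' pth' uniqp _ {p} def_b.
case: p' pth' uniqp def_b => // z p pth uniqp def_b.
case: (acyc [:: t, c, z & p]) => //; apply/andP; split.
  have : path (adj T) c (rcons (z :: p) t).
    rewrite rcons_path -def_b adjC ab andbT.
    by apply: sub_path pth => u v; rewrite adj_induced => /andP[].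
  by rewrite /= tc.
rewrite cons_uniq uniqp andbT; apply/negP => tin.
have allA : all (mem (A :\ t)) (z :: p).
  elim: (z :: p) (c) (cAt) pth => // z' p0 IH c0 c0A /=.
  by rewrite adj_induced => /andP[/and3P[_ _ z'A] /(IH _ z'A)->]; rewrite z'A.
move: tin; rewrite in_cons (negPf (adj_neq tc)) /= => tin.
by have := allP allA _ tin; rewrite /= !inE eqxx.
Qed.

Lemma tree_rooted_tree : is_tree T ->
  exists t, rooted_tree (vset T) t.
Proof.
move=> [/set0Pn[t tT] con acyc]; exists t; apply: connected_rooted_tree => //.
by rewrite induced_id // => a aT; apply: con.
Qed.

End RootedTrees.

(** * Complete binary trees in large trees of bounded degree and depth *)

Section BinaryRank.
Variables (V : finType) (G : sgraph V).
Implicit Types (S : {set V}) (x y z : V).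

(* [binary_rank j S x]: some tree inside [S] with root [x] contracts onto the
   complete binary tree of height [j] with its root coming from [x]. *)
Inductive binary_rank : nat -> {set V} -> V -> Prop :=
| BinaryLeaf S x of x \in S : binary_rank 0 S x
| BinaryStep j S S' x y of
    x \in S & x \notin S' & S' \subset S & adj G x y & binary_rank j S' y
  : binary_rank j S x
| BinaryFork j S S1 S2 x y z of
    x \in S & x \notin S1 & x \notin S2 & S1 \subset S & S2 \subset S
    & [disjoint S1 & S2] & adj G x y & adj G x z
    & binary_rank j S1 y & binary_rank j S2 z
  : binary_rank j.+1 S x.

Section Models.
Variables (W : finType) (T : sgraph W).
Implicit Types (A B : {set W}) (phi psi : V -> option W).

Lemma fiber_connect_ext phi psi x y w :
  (forall z w, phi z = Some w -> psi z = Some w) -> phi x = Some w ->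
  connect (fiber_adj G phi) x y -> connect (fiber_adj G psi) x y.
Proof.
move=> ext dx /connectP[p pth ->].
elim: p x dx pth => [|z p IHp] x dx /=; first by rewrite connect0.
move=> /andP[/andP[xz /eqP eqf]] pth; have dz : phi z = Some w by rewrite -eqf.
apply: connect_trans (IHp z dz pth); apply: connect1.
by rewrite /fiber_adj xz (ext _ _ dx) (ext _ _ dz) eqxx.
Qed.

Lemma fiber_adjC phi x y :
  connect (fiber_adj G phi) x y = connect (fiber_adj G phi) y x.
Proof.
apply: sym_connect_sym => a b.
by rewrite /fiber_adj adjC eq_sym.
Qed.

Lemma model_sub S S' A phi : S \subset S' ->
  minor_model T G S A phi -> minor_model T G S' A phi.
Proof.
move=> /subsetP sub [dom onto conn edge]; split=> // x w /dom[xS wA].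
by split=> //; apply: sub.
Qed.

Lemma model_single S x t : x \in S ->
  minor_model T G S [set t] (fun z => if z == x then Some t else None).
Proof.
move=> xS; split.
- by move=> z w; have [->|] := eqVneq z x => // -[<-]; rewrite inE.
- by move=> w; rewrite inE => /eqP->; exists x; rewrite eqxx.
- move=> a b w; have [->|] := eqVneq a x => // _.
  by have [->|] := eqVneq b x => // _; rewrite connect0.
by move=> a b; rewrite !inE => /eqP-> /eqP-> /adj_neq; rewrite eqxx.
Qed.

(** The new vertex [x] joins the branch set of its neighbour [y]. This moves the root of the host
    tree upwards. *)
Lemma model_extend S A phi x y t : x \notin S -> adj G x y ->
  phi y = Some t -> minor_model T G S A phi ->
  minor_model T G (x |: S) A (fun z => if z == x then Some t else phi z).
Proof.
move=> xS xy dy [dom onto conn edge]; set psi := fun z => _.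
have ext z w : phi z = Some w -> psi z = Some w.
  rewrite /psi; case: eqP => [-> /dom[]|//]; by rewrite (negPf xS).
have psix : psi x = Some t by rewrite /psi eqxx.
have psiS z w : psi z = Some w -> phi z = Some w \/ (z = x /\ w = t).
  by rewrite /psi; case: eqP => [-> [->]|_]; [right|left].
have connx z : phi z = Some t -> connect (fiber_adj G psi) x z.
  move=> dz; apply: (@connect_trans _ _ y).
    by apply: connect1; rewrite /fiber_adj xy psix (ext _ _ dy) eqxx.
  exact: fiber_connect_ext ext dy (conn _ _ _ dy dz).
split.
- move=> z w /psiS[/dom[zS wA]|[-> ->]]; rewrite !inE ?eqxx ?zS ?orbT //.
  by have [] := dom _ _ dy.
- by move=> w /onto[z dz]; exists z; apply: ext.
- move=> a b w /psiS[da|[-> ->]] /psiS[db|[-> eqw]].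
  + exact: fiber_connect_ext ext da (conn _ _ _ da db).
  + by rewrite fiber_adjC; apply: connx; rewrite -eqw.
  + exact: connx.
  + exact: connect0.
move=> a b aA bA /(edge _ _ aA bA)[u [v [du dv uv]]].
by exists u, v; split=> //; apply: ext.
Qed.

(** The only possible edge of [T] between [A] and [B] is [tc], and [xz] realizes it. *)
Lemma model_join S1 S2 A B phi1 phi2 x z t c :
  [disjoint S1 & S2] -> [disjoint A & B] ->
  (forall a b, a \in A -> b \in B -> adj T a b -> a = t /\ b = c) ->
  minor_model T G S1 A phi1 -> minor_model T G S2 B phi2 ->
  phi1 x = Some t -> phi2 z = Some c -> adj G x z ->
  minor_model T G (S1 :|: S2) (A :|: B)
    (fun y => if phi1 y is Some w then Some w else phi2 y).
Proof.
move=> disS disA cross [dom1 onto1 conn1 edge1] [dom2 onto2 conn2 edge2] dx dz xz.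
set psi := fun y => _.
have ext1 y w : phi1 y = Some w -> psi y = Some w by rewrite /psi => ->.
have ext2 y w : phi2 y = Some w -> psi y = Some w.
  move=> dy; rewrite /psi; case d1: (phi1 y) => [w'|] //.
  have [y1 _] := dom1 _ _ d1; have [y2 _] := dom2 _ _ dy.
  by rewrite (disjointFr disS y1) in y2.
have psiS y w : psi y = Some w -> phi1 y = Some w \/ phi2 y = Some w.
  by rewrite /psi; case: (phi1 y) => [w' [->]|]; [left|right].
split.
- by move=> y w /psiS[/dom1[yS wA]|/dom2[yS wA]]; rewrite !inE yS wA ?orbT.
- move=> w; rewrite inE => /orP[/onto1|/onto2] [y dy]; exists y.
    exact: ext1.
  exact: ext2.
- move=> a b w /psiS[da|da] /psiS[db|db].
  + exact: fiber_connect_ext ext1 da (conn1 _ _ _ da db).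
  + have [_ w1] := dom1 _ _ da; have [_ w2] := dom2 _ _ db.
    by rewrite (disjointFr disA w1) in w2.
  + have [_ w1] := dom1 _ _ db; have [_ w2] := dom2 _ _ da.
    by rewrite (disjointFr disA w1) in w2.
  + exact: fiber_connect_ext ext2 da (conn2 _ _ _ da db).
move=> a b; rewrite !inE => /orP[aA|aB] /orP[bA|bB] ab.
- by have [u [v [du dv uv]]] := edge1 _ _ aA bA ab; exists u, v; split; auto.
- by have [-> ->] := cross _ _ aA bB ab; exists x, z; split; auto.
- rewrite adjC in ab; have [-> ->] := cross _ _ bA aB ab; exists z, x.
  by rewrite adjC; split; auto.
by have [u [v [du dv uv]]] := edge2 _ _ aB bB ab; exists u, v; split; auto.
Qed.

(** At a fork, the subtree of [y] together with [x] hosts the part of the tree with the root, and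
    the subtree of [z] hosts the other part. Both parts are nonempty, so each has at least one
    vertex less than the whole, matching the drop in rank. *)
Lemma binary_rank_model j S x A t : binary_rank j S x -> rooted_tree T A t ->
  #|A| <= j.+1 -> exists2 phi, minor_model T G S A phi & phi x = Some t.
Proof.
move=> rk; elim: rk A t => {j S x}
  [S x xS|j S S' x y xS xS' sub xy _ IH|
   j S S1 S2 x y z xS xS1 xS2 sub1 sub2 dis xy xz _ IH1 _ IH2] A t tree leA.
- have -> : A = [set t].
    apply/esym/eqP; rewrite eqEcard cards1 leA andbT sub1set.
    exact: rooted_tree_root tree.
  exists (fun z => if z == x then Some t else None); last by rewrite eqxx.
  exact: model_single.
- have [phi mod dy] := IH A t tree leA.
  exists (fun z => if z == x then Some t else phi z); last by rewrite eqxx.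
  apply: model_sub (model_extend xS' xy dy mod).
  by rewrite subUset sub1set xS.
case: tree leA => {A t} [t _|A B t c treeA treeB disA tc cross].
  exists (fun z => if z == x then Some t else None); last by rewrite eqxx.
  exact: model_single.
rewrite cardsU; have /eqP -> : A :&: B == set0 by rewrite setI_eq0.
rewrite cards0 subn0 => leAB.
have A0 : 0 < #|A| by apply/card_gt0P; exists t; apply: rooted_tree_root treeA.
have B0 : 0 < #|B| by apply/card_gt0P; exists c; apply: rooted_tree_root treeB.
have [leA leB] : #|A| <= j.+1 /\ #|B| <= j.+1 by move: A0 B0 leAB; clear; lia.
have [phi1 mod1 dy] := IH1 A t treeA leA.
have [phi2 mod2 dz] := IH2 B c treeB leB.
have mod1' := model_extend xS1 xy dy mod1.
set psi := fun u => _ in mod1'.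
have dx : psi x = Some t by rewrite /psi eqxx.
have disx : [disjoint x |: S1 & S2].
  rewrite -setI_eq0 setIUl setU_eq0 !setI_eq0 dis andbT disjoints1; exact: xS2.
exists (fun u => if psi u is Some w then Some w else phi2 u); last by rewrite dx.
apply: model_sub (model_join disx disA cross mod1' mod2 dx dz xz).
by rewrite !subUset sub1set xS sub1 sub2.
Qed.

End Models.

Variables (d : nat) (parent : V -> V) (level : V -> nat).
Hypothesis deg_le : forall x, #|[set y | adj G x y]| <= d.

(** The pointers [parent] make [S] a tree of depth at most [r] with root [x]. Levels are absolute,
    so that a branch inherits [parent] and [level] unchanged. *)
Definition is_rooted_at S x r :=
  [/\ x \in S,
      forall z, z \in S -> level x <= level z <= level x + r
    & forall z, z \in S -> z != x ->
        [/\ parent z \in S, adj G (parent z) z & level z = (level (parent z)).+1]].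

(** For [z] properly below [x], this climbs to the level just below [x], that is, to the child of
    [x] whose branch contains [z]. *)
Definition ancestor x z := iter (level z - (level x).+1) parent z.

Definition branch S x y := [set z in S | (z != x) && (ancestor x z == y)].

Definition children S x := [set y in S | (y != x) && (parent y == x)].

Lemma ancestor_children S x r z : is_rooted_at S x r -> z \in S -> z != x ->
  ancestor x z \in children S x.
Proof.
move=> [xS lev par] zS zx; rewrite /ancestor.
have [_ _ lz] := par z zS zx.
have : level z = (level x).+1 + (level z - (level x).+1).
  by have [pzS _ _] := par z zS zx; have /andP[] := lev _ pzS; lia.
move: (_ - _) => m; elim: m z zS zx {lz} => [|m IHm] z zS zx lz.
  rewrite /= inE zS zx /=; have [pS _ lp] := par z zS zx.
  apply/negPn/negP => px; have [ppS _ lpp] := par _ pS px.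
  by have /andP[] := lev _ ppS; lia.
rewrite iterSr; have [pS _ lp] := par z zS zx; apply: IHm => //; last by lia.
by apply/eqP => px; rewrite px in lp; lia.
Qed.

Lemma level_child S x r y : is_rooted_at S x r -> y \in children S x ->
  level y = (level x).+1.
Proof.
move=> [_ _ par]; rewrite inE => /and3P[yS yx /eqP py].
by have [_ _ ->] := par y yS yx; rewrite py.
Qed.

Lemma branch_rooted S x r y : is_rooted_at S x r.+1 -> y \in children S x ->
  is_rooted_at (branch S x y) y r.
Proof.
move=> root yC; have ly := level_child root yC.
have [xS lev par] := root; have := yC; rewrite inE => /and3P[yS yx _].
split.
- by rewrite inE yS yx /ancestor ly subnn /=.
- move=> z; rewrite inE => /and3P[zS zx _]; rewrite ly.
  have [pS _ lz] := par z zS zx; have /andP[] := lev _ pS.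
  by have /andP[] := lev _ zS; lia.
move=> z; rewrite inE => /and3P[zS zx /eqP az] zy.
have [pS adjz lz] := par z zS zx; split=> //.
have nlz : level z != (level x).+1.
  by apply: contra zy => /eqP lz'; rewrite -az /ancestor lz' subnn.
have /andP[lp _] := lev _ pS.
have px : parent z != x by apply/eqP => px; move: nlz; rewrite lz px eqxx.
rewrite inE pS px /=; rewrite /ancestor in az *; rewrite -az.
have -> : level z - (level x).+1 = (level (parent z) - (level x).+1).+1.
  have [ppS _ lpp] := par _ pS px; have /andP[+ _] := lev _ ppS.
  by move: lz lpp; clear; lia.
by rewrite iterSr.
Qed.

Lemma card_branches S x r : is_rooted_at S x r ->
  #|S| = (\sum_(y in children S x) #|branch S x y|).+1.
Proof.
move=> root; have [xS _ _] := root.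
rewrite (cardsD1 x) xS add1n -sum1_card; congr _.+1.
rewrite (partition_big (ancestor x) (mem (children S x))) /=; last first.
  move=> z; rewrite !inE => /andP[zx zS].
  by have := ancestor_children root zS zx; rewrite inE.
apply: eq_bigr => y _; rewrite -sum1_card; apply: eq_bigl => z.
by rewrite !inE; case: (z \in S); case: (z == x).
Qed.

Lemma card_children S x r : is_rooted_at S x r -> #|children S x| <= d.
Proof.
move=> [_ _ par]; apply: leq_trans (deg_le x); apply: subset_leq_card.
apply/subsetP => y; rewrite !inE => /and3P[yS yx /eqP <-].
by have [] := par y yS yx.
Qed.

(** Induction on [j], then on [r]. With [q = (d + 1)(r + 1)], a branch with more than [q ^ (j + 1)]
    vertices already has rank [j + 1], and two branches with more than [q ^ j] vertices form a fork.
    If neither occurs, [S] is too small. *)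
Lemma binary_rank_large j r S x : is_rooted_at S x r ->
  (d.+1 * r.+1) ^ j < #|S| -> binary_rank j S x.
Proof.
elim: j r S x => [|j IHj] r S x root; first by case: root => xS _ _ _; apply: BinaryLeaf.
elim: r S x root => [|r IHr] S x root ltS.
  have [xS lev par] := root.
  have : S \subset [set x].
    apply/subsetP => z zS; rewrite inE; apply/negPn/negP => zx.
    have [pS _ lz] := par z zS zx; have /andP[_] := lev _ zS.
    by have /andP[] := lev _ pS; lia.
  move=> /subset_leq_card; rewrite cards1 => le1.
  by have := leq_trans ltS le1; rewrite ltnS leqn0 expn_eq0.
have [xS _ par] := root.
have subx y : branch S x y \subset S by apply/subsetP => z; rewrite inE => /andP[].
have xbr y : x \notin branch S x y by rewrite inE eqxx andbF.
have adjx y : y \in children S x -> adj G x y.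
  by rewrite inE => /and3P[yS yx /eqP<-]; have [] := par y yS yx.
set q := d.+1 * r.+1 in IHr *.
have [/exists_inP[y yC lty]|/exists_inPn small1] := boolP
    [exists y in children S x, q ^ j.+1 < #|branch S x y|].
  apply: (BinaryStep xS (xbr y) (subx y) (adjx y yC)).
  exact: IHr (branch_rooted root yC) lty.
have sum_bound (P : pred V) :
    (forall y, y \in children S x -> P y -> #|branch S x y| <= q ^ j) ->
    \sum_(y in children S x | P y) #|branch S x y| <= d * q ^ j.
  move=> le; apply: (@leq_trans (\sum_(y in children S x | P y) q ^ j)).
    by apply: leq_sum => y /andP[yC Py]; apply: le.
  rewrite sum_nat_const leq_mul2r; apply/orP; right.
  apply: leq_trans (card_children root); apply: subset_leq_card.
  by apply/subsetP => y /andP[].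
(* For depth [r + 1] the assumed bound is [(d + 1 + q) ^ (j + 1)], which is at least
   [(d + 1) q ^ j + q ^ (j + 1)]; the spare [q ^ j] pays for the root. *)
have le_sum : d * q ^ j + q ^ j.+1 < \sum_(y in children S x) #|branch S x y|.
  rewrite -ltnS -(card_branches root); apply: leq_trans ltS.
  have q0 : 0 < q ^ j by rewrite expn_gt0.
  have leq_q : q ^ j <= (d.+1 + q) ^ j.
    by case: (j) => // j'; rewrite leq_exp2r // leq_addl.
  rewrite mulnS -/q !expnS ltnS.
  apply: leq_trans (leq_mul (leqnn _) leq_q); rewrite mulnDl mulSn; lia.
have [/exists_inP[y yC lty]|/exists_inPn small0] := boolP
    [exists y in children S x, q ^ j < #|branch S x y|]; last first.
  have : \sum_(y in children S x) #|branch S x y| <= d * q ^ j.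
    rewrite (eq_bigl (fun y => (y \in children S x) && predT y)) => [|y].
      by apply: sum_bound => y yC _; rewrite leqNgt; apply: small0.
    by rewrite andbT.
  by rewrite leqNgt (leq_ltn_trans _ le_sum) // leq_addr.
have [/existsP[z /and3P[zC zy ltz]]|/existsPn none] := boolP
    [exists z, [&& z \in children S x, z != y & q ^ j < #|branch S x z|]].
  apply: (BinaryFork xS (xbr y) (xbr z) (subx y) (subx z) _ (adjx y yC) (adjx z zC)).
  - rewrite -setI_eq0; apply/eqP/setP => u; rewrite !inE.
    apply/negP => /andP[/and3P[_ _ /eqP uy] /and3P[_ _ /eqP uz]].
    by rewrite -uy -uz eqxx in zy.
  - exact: IHj (branch_rooted root yC) lty.
  - exact: IHj (branch_rooted root zC) ltz.
(* Only [y] has a branch above [q ^ j], and even that one is at most [q ^ (j + 1)]. *)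
rewrite (bigD1 y) //= in le_sum.
have le1 : #|branch S x y| <= q ^ j.+1 by rewrite leqNgt; apply: small1.
have le2 : \sum_(z in children S x | z != y) #|branch S x z| <= d * q ^ j.
  by apply: sum_bound => z zC zy; have := none z; rewrite zC zy /= -leqNgt.
by have := leq_add le1 le2; rewrite leqNgt addnC le_sum.
Qed.

End BinaryRank.

(** * Balls, their exploration by BFS and their edge boundaries *)

Section Balls.
Variables (V : finType) (G : sgraph V).
Implicit Types (S L U : {set V}) (F : {set {set V}}) (s x y z : V).

Definition grow S := S :|: [set y | [exists x in S, adj G x y]].

Definition ball n s := iter n grow [set s].

Lemma sub_grow S : S \subset grow S. Proof. exact: subsetUl. Qed.

Lemma adj_grow S x y : x \in S -> adj G x y -> y \in grow S.
Proof. by move=> xS xy; rewrite !inE; apply/orP; right; apply/exists_inP; exists x. Qed.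

Lemma sub_ball m n s : m <= n -> ball m s \subset ball n s.
Proof.
move=> /subnK<-; elim: (n - m) => //= i IHi.
exact: subset_trans IHi (sub_grow _).
Qed.

Lemma ball_center n s : s \in ball n s.
Proof. by apply: (subsetP (sub_ball s (leq0n n))); rewrite inE. Qed.

Lemma ball_vset n s : s \in vset G -> ball n s \subset vset G.
Proof.
move=> sG; elim: n => [|n IHn]; first by rewrite sub1set.
apply/subsetP => y; rewrite [ball _ _]/= !inE => /orP[/(subsetP IHn)//|].
by move=> /exists_inP[x _ /adj_vsetr].
Qed.

Lemma bfs_found_sub n S L F : F \subset (bfs G n S L F).2.
Proof.
elim: n S L F => //= n IHn S L F; case: ifP => // _.
exact: subset_trans (subsetUl _ _) (IHn _ _ _).
Qed.

(** The hypotheses are the BFS invariant: seen vertices off the current layer have all their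
    neighbours seen and all their edges found. *)
Lemma grow_bfs n S L F :
  L \subset S ->
  (forall x y, x \in S :\: L -> adj G x y -> y \in S) ->
  (forall e, e \in eset G -> ~~ [disjoint e & S :\: L] -> e \in F) ->
  iter n grow S \subset (bfs G n S L F).1 /\
  (forall i e, i < n -> e \in eset G -> ~~ [disjoint e & iter i grow S] ->
    e \in (bfs G n S L F).2).
Proof.
elim: n S L F => [|n IHn] S L F sLS closed found; first by [].
(* With an empty layer [S] is closed under adjacency, so stopping early loses nothing: all larger
   balls equal [S]. *)
have [L0|nL0] := eqVneq L set0.
  have growS : grow S = S.
    apply/setUidPl/subsetP => y; rewrite inE => /exists_inP[x xS].
    by apply: closed; rewrite L0 setD0.
  have iterS i : iter i grow S = S by elim: i => //= i ->.
  rewrite iterS /bfs L0 eqxx /=; split=> // i e _ eG.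
  by rewrite iterS => dis; apply: found => //; rewrite L0 setD0.
set nxt := [set y | [exists x in L, adj G x y]] :\: S.
(* New vertices can only be neighbours of [L], by the invariant. *)
have growE : S :|: nxt = grow S.
  apply/setP => y; rewrite !inE; case: (boolP (y \in S)) => //= yS.
  apply/exists_inP/exists_inP => -[x xL xy]; exists x => //.
    exact: subsetP xL.
  apply: contraNT yS => nxL; apply: closed xy; by rewrite inE nxL.
have defS : grow S :\: nxt = S.
  rewrite -growE; apply/setP => y; rewrite !inE.
  by case: (y \in S) => //=; case: [exists _ in _, _].
have covered e : e \in eset G -> ~~ [disjoint e & S] ->
    e \in F :|: [set e in eset G | ~~ [disjoint e & L]].
  move=> eG dis; rewrite !inE eG /=.
  case: (boolP [disjoint e & L]) => disL; rewrite ?orbT // orbF; apply: found => //.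
  apply: contra dis => disSL; rewrite -setI_eq0; apply/eqP/setP => y.
  rewrite !inE; apply/negP => /andP[ye yS].
  have := disjointFr disL ye; have := disjointFr disSL ye.
  by rewrite inE yS andbT => /negbT/negPn->.
have [||| sub sube] := IHn (grow S) nxt
    (F :|: [set e in eset G | ~~ [disjoint e & L]]).
- by rewrite -growE subsetUr.
- by rewrite defS => x y; apply: adj_grow.
- by rewrite defS.
rewrite /= (negPf nL0) -/nxt growE -iterS iterSr; split=> // -[|i] e lti eG dis.
  by apply: (subsetP (bfs_found_sub _ _ _ _)); apply: covered.
by apply: (sube i e lti eG); rewrite -iterSr.
Qed.

(** The radius is strictly below [D] for edges, because an edge joining two vertices at distance
    exactly [D] is not discovered. *)
Lemma ball_explored D s :
  ball D s \subset vset (explored_subgraph G D s) /\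
  (forall n, n < D -> eset (induced G (ball n s)) \subset
     eset (explored_subgraph G D s)).
Proof.
have [|||sub sube] := @grow_bfs D [set s] [set s] set0.
- exact: subxx.
- by move=> x y; rewrite setDv in_set0.
- by move=> e eG; rewrite setDv -setI_eq0 setI0 eqxx.
split=> // n ltn; apply/subsetP => e; rewrite eset_induced => /andP[eG eB].
apply: (sube n) => //; have [x [y [def_e _]]] := esetE eG.
apply/pred0Pn; exists x => /=; have xe : x \in e by rewrite def_e !inE eqxx.
by rewrite xe (subsetP eB).
Qed.

Definition boundary S := [set e in eset G | ~~ [disjoint e & S] && ~~ (e \subset S)].

Lemma card_nbrs d x : max_degree_le G d -> #|[set y | adj G x y]| <= d.
Proof.
move=> deg; apply: leq_trans (deg x).
have inj : {in [set y | adj G x y] &, injective (fun y => [set x; y])}.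
  move=> y z; rewrite !inE => xy xz /setP/(_ y); rewrite !inE eqxx orbT.
  by rewrite eq_sym (negPf (adj_neq xy)) => /esym/eqP.
rewrite -(card_in_imset inj); apply: subset_leq_card; apply/subsetP => e.
by move=> /imsetP[y]; rewrite !inE => xy ->; rewrite [_ \in _]xy !inE eqxx.
Qed.

Lemma card_edges_meeting d S : max_degree_le G d ->
  #|[set e in eset G | ~~ [disjoint e & S]]| <= d * #|S|.
Proof.
move=> deg; rewrite mulnC -sum_nat_const.
apply: (@leq_trans (\sum_(x in S) #|[set e in eset G | x \in e]|)); last first.
  by apply: leq_sum => x _; apply: deg.
apply: (@leq_trans #|\bigcup_(x in S) [set e in eset G | x \in e]|); last first.
  elim/big_rec2: _ => [|x A m _ IH]; first by rewrite cards0.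
  by apply: leq_trans (leq_card_setU _ _) _; rewrite leq_add2l.
apply: subset_leq_card.
apply/subsetP => e; rewrite inE => /andP[eG /pred0Pn[x /andP[/= xe xS]]].
by apply/bigcupP; exists x => //; rewrite inE eG.
Qed.

(** The outer end of a boundary edge is one of the vertices gained by the next ball, and each of
    these meets at most [d] edges. *)
Lemma boundary_ball d n s : max_degree_le G d ->
  #|boundary (ball n s)| + d * #|ball n s| <= d * #|ball n.+1 s|.
Proof.
move=> deg; have sub := sub_grow (ball n s).
rewrite [ball n.+1 s]/= -(cardsID (ball n s) (grow (ball n s))) (setIidPr sub).
rewrite mulnDr addnC leq_add2l.
apply: leq_trans (card_edges_meeting _ deg); apply: subset_leq_card.
apply/subsetP => e; rewrite !inE => /and3P[eG /pred0Pn[x /andP[/= xe xB]]].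
move=> /subsetPn[y ye yB]; rewrite eG /=; apply/pred0Pn; exists y => /=.
rewrite ye inE yB /=; apply: (adj_grow xB); rewrite /adj.
suff -> : [set x; y] = e by [].
have xy : x != y by apply: contraNneq yB => <-.
have [c2 _] := eset_wf eG; apply/eqP; rewrite eqEcard c2 cards2 xy andbT.
by rewrite subUset !sub1set xe ye.
Qed.

End Balls.

Lemma ball_induced (V : finType) (G : sgraph V) U n s :
  ball (induced G U) n s \subset ball G n s.
Proof.
elim: n => //= n IHn; apply/subsetP => y; rewrite inE => /orP[yB|].
  by apply: (subsetP (sub_grow _ _)); apply: subsetP yB.
rewrite inE => /exists_inP[x xB]; rewrite adj_induced => /and3P[xy _ _].
exact: adj_grow (subsetP IHn _ xB) xy.
Qed.

(** * The BFS tree of a large ball and its minors *)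

Section LargeBalls.
Variables (V : finType) (K : sgraph V) (s : V) (n : nat).

(** The distance from [s] within the ball of radius [n], and [n + 1] outside it. *)
Definition ball_level z := find (fun i => z \in ball K i s) (iota 0 n.+1).

Definition ball_parent z :=
  odflt z [pick x in ball K (ball_level z).-1 s | adj K x z].

Lemma ball_levelP z : z \in ball K n s ->
  ball_level z <= n /\ z \in ball K (ball_level z) s.
Proof.
move=> zB; have hasz : has (fun i => z \in ball K i s) (iota 0 n.+1).
  by apply/hasP; exists n => //; rewrite mem_iota /= ltnS.
have lt : ball_level z < n.+1 by rewrite -[X in _ < X](size_iota 0) -has_find.
split=> //; have := nth_find 0 hasz; by rewrite nth_iota.
Qed.

Lemma ball_level_le z i : i <= n -> z \in ball K i s -> ball_level z <= i.
Proof.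
move=> le_in zB; rewrite leqNgt; apply/negP => lti.
have := before_find 0 lti; rewrite nth_iota ?ltnS //.
by rewrite add0n zB.
Qed.

Lemma ball_rooted :
  is_rooted_at (induced K (ball K n s)) ball_parent ball_level (ball K n s) s n.
Proof.
have ls : ball_level s = 0.
  by apply/eqP; rewrite -leqn0; apply: ball_level_le; rewrite ?inE.
split; first exact: ball_center.
  by move=> z /ball_levelP[le _]; rewrite ls.
move=> z zB zs; have [le zl] := ball_levelP zB.
case def_l: (ball_level z) => [|l] in le zl.
  by move: zl; rewrite inE (negPf zs).
have nzl : z \notin ball K l s.
  apply/negP => /(ball_level_le (ltnW le)); by rewrite def_l ltnn.
rewrite /ball_parent def_l /=; case: pickP => [x /andP[xl xz]|none]; last first.
  move: zl; rewrite [ball _ _ _]/= inE (negPf nzl) inE /= => /exists_inP[x xl xz].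
  by have := none x; rewrite xl xz.
have xB : x \in ball K n s by apply: subsetP xl; apply: sub_ball; apply: ltnW.
split=> //=; first by rewrite adj_induced xz xB zB.
(* A parent of level below [l] would place [z] in the ball of radius [l]. *)
congr _.+1; apply/eqP; rewrite eqn_leq (ball_level_le _ xl) ?(ltnW le) // andbT.
have [lx xlx] := ball_levelP xB; rewrite leqNgt; apply/negP => ltl.
have : z \in ball K (ball_level x).+1 s by apply: adj_grow xlx xz.
move=> /ball_level_le; rewrite def_l => /(_ (leq_trans ltl (ltnW le))).
by rewrite ltnS leqNgt ltl.
Qed.

Lemma large_ball_has_minor (W : finType) (T : sgraph W) d j :
  max_degree_le K d -> s \in vset K -> is_tree T -> #|vset T| <= j.+1 ->
  (d.+1 * n.+1) ^ j < #|ball K n s| -> has_minor T (induced K (ball K n s)).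
Proof.
move=> deg sK treeT leT ltB; have [T0 _ _] := treeT.
have [t rooted] := tree_rooted_tree treeT.
have nbrs x : #|[set y | adj (induced K (ball K n s)) x y]| <= d.
  apply: leq_trans (card_nbrs x deg); apply: subset_leq_card.
  by apply/subsetP => y; rewrite !inE adj_induced => /and3P[].
have rk := binary_rank_large nbrs ball_rooted ltB.
have [phi mod _] := binary_rank_model rk rooted leT.
apply: model_has_minor T0 (model_sub _ mod).
by rewrite /= subsetI ball_vset //=.
Qed.

End LargeBalls.

Local Open Scope ring_scope.

(** * Exponential against polynomial growth *)

Section Numerics.
Variable R : realType.
Implicit Types (x c eps : R).

Lemma ceil_nat_itv x : 0 <= x -> x <= (ceil_nat x)%:R < x + 1.
Proof.
move=> x0; rewrite /ceil_nat natr_absz ger0_norm; last first.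
  by rewrite ceil_ge0 (lt_le_trans _ x0) // ltrN10.
rewrite ceil_ge /=; have := ceilB1_lt x; rewrite intrB; lra.
Qed.

Lemma bernoulli c n : 0 <= c -> 1 + n%:R * c <= (1 + c) ^+ n.
Proof.
move=> c0; elim: n => [|n IHn]; first by rewrite mul0r addr0 expr0.
rewrite exprS; have : (1 + c) * (1 + n%:R * c) <= (1 + c) * (1 + c) ^+ n.
  by apply: ler_wpM2l => //; lra.
apply: le_trans; rewrite -natr1.
have : 0 <= n%:R * (c * c) by rewrite !mulr_ge0.
by rewrite !mulrDl !mulrDr !mul1r !mulr1; lra.
Qed.

Lemma cube_lt_exp5 u : (0 < u)%N -> (u * (u ^ 2).+1 < 5 ^ u)%N.
Proof.
case: u => // u _; elim: u => // u IHu; rewrite expnS.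
by apply: (@leq_trans (5 * (u.+1 * (u.+1 ^ 2).+1).+1)); [nia|rewrite leq_mul2l].
Qed.

(** Let [x] be the ceiling of [X = 8 d / eps]. Bernoulli gives [(1 + eps / 2) ^ x >= 5]. The radius
    [n = (x k) ^ 2] is [x] times [x k k], so growth reaches [5 ^ (x k k)], the [k]-th power of
    [5 ^ (x k)]. *)
Lemma growth_beats_tree_size (k d : nat) eps :
  (0 < k)%N -> (0 < d)%N -> 0 < eps -> eps <= 1 ->
  exists2 n, (n < bfs_depth k d eps)%N
    & ((d.+1 * n.+1) ^ k)%:R < (1 + eps / 2) ^+ n.
Proof.
move=> k0 d0 e0 e1; pose X := 8 * d%:R / eps.
have d1 : 1 <= d%:R :> R by rewrite ler1n.
have k1 : 1 <= k%:R :> R by rewrite ler1n.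
have eX : eps * X = 8 * d%:R by rewrite /X mulrC divfK // gt_eqF.
have X8 : 8 * d%:R <= X by rewrite -eX; nra.
have X0 : 0 <= X by lra.
have /andP[leXx ltxX] := ceil_nat_itv X0; set x := ceil_nat X in leXx ltxX.
have ledx : (d.+1 <= x)%N by rewrite -(ler_nat R) -natr1; lra.
have x0 : (0 < x)%N by apply: leq_trans ledx.
exists ((x * k) ^ 2)%N.
  rewrite -(ltr_nat R); set Y := k%:R * X ^+ (4 * k + 2).
  have Y0 : 0 <= Y by rewrite mulr_ge0 // exprn_ge0.
  have /andP[leY _] := ceil_nat_itv Y0; apply: lt_le_trans leY.
  (* Since [x <= 2 X], the radius is at most [X ^ 2 k] times [4 k], while the depth is at least
     [X ^ 2 k] times [X ^ (4 k)]. *)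
  have ltk : (4 * k)%:R < X ^+ (4 * k).
    apply: (@lt_le_trans _ _ ((2 ^ (4 * k))%:R)); first by rewrite ltr_nat ltn_expl.
    by rewrite natrX lerXn2r ?nnegrE //; lra.
  have leX : (x * k)%:R ^+ 2 <= 4 * (X ^+ 2 * k%:R ^+ 2).
    rewrite natrM exprMn mulrA ler_wpM2r ?exprn_ge0 //.
    have -> : 4 * X ^+ 2 = (2 * X) ^+ 2 by ring.
    by rewrite lerXn2r ?nnegrE //; lra.
  rewrite natrX; apply: le_lt_trans leX _.
  have -> : Y = (X ^+ 2 * k%:R) * X ^+ (4 * k) by rewrite /Y exprD; ring.
  have -> : 4 * (X ^+ 2 * k%:R ^+ 2) = (X ^+ 2 * k%:R) * (4 * k)%:R.
    by rewrite natrM; ring.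
  by rewrite ltr_pM2l // mulr_gt0 ?exprn_gt0 //; lra.
have le5 : 5 <= (1 + eps / 2) ^+ x.
  apply: le_trans (bernoulli x _); last by lra.
  have : X * eps <= x%:R * eps by rewrite ler_wpM2r // ltW.
  by rewrite [X * eps]mulrC eX; lra.
have -> : ((x * k) ^ 2 = x * (x * k * k))%N by rewrite -mulnn; ring.
rewrite exprM; apply: (@lt_le_trans _ _ (5 ^+ (x * k * k))); last first.
  by rewrite lerXn2r ?nnegrE ?exprn_ge0 //; lra.
(* After taking [k]-th roots it remains to see [(d + 1)(u ^ 2 + 1) < 5 ^ u] for [u = x k], where
   [d + 1 <= x <= u]. *)
rewrite -natrX ltr_nat expnM ltn_exp2r //.
have -> : (x * (x * k * k) = (x * k) ^ 2)%N by rewrite -mulnn; ring.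
apply: leq_ltn_trans (cube_lt_exp5 _); last by rewrite muln_gt0 x0.
by rewrite leq_mul2r (leq_trans ledx) ?orbT // leq_pmulr.
Qed.

(** A boundary of more than [c d] edges per vertex needs more than [c] new vertices per old one, as
    a new vertex absorbs at most [d] of them. *)
Lemma ball_growth (V : finType) (K : sgraph V) (d n : nat) (s : V) c :
  (0 < d)%N -> 0 <= c -> max_degree_le K d ->
  (forall i, (i < n)%N ->
     c * d%:R * #|ball K i s|%:R < #|boundary K (ball K i s)|%:R) ->
  (1 + c) ^+ n <= #|ball K n s|%:R.
Proof.
move=> d0 c0 deg; elim: n => [|n IHn] dense; first by rewrite cards1 expr0.
have {}IHn := IHn (fun i lti => dense i (ltnW lti)).
have := boundary_ball n s deg; rewrite -(ler_nat R) natrD !natrM => leb.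
have {}dense := dense n (ltnSn n).
rewrite exprS -(@ler_pM2l _ d%:R) ?ltr0n //.
apply: le_trans leb; apply: (@le_trans _ _ (d%:R * ((1 + c) * #|ball K n s|%:R))).
  by rewrite ler_pM2l ?ltr0n // ler_wpM2l //; lra.
lra.
Qed.

End Numerics.

(** * Cutting a graph into minor-free clusters *)

Lemma induced_induced (V : finType) (G : sgraph V) (U B : {set V}) :
  B \subset U -> induced (induced G U) B = induced G B.
Proof.
move=> sBU; apply: sgraph_eq; first by rewrite /= -setIA (setIidPr sBU).
apply/setP => e; rewrite !eset_induced -andbA; congr andb.
by apply: andb_idl => sub; apply: subset_trans sBU.
Qed.

Lemma max_degree_induced (V : finType) (G : sgraph V) (U : {set V}) d :
  max_degree_le G d -> max_degree_le (induced G U) d.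
Proof.
move=> deg v; apply: leq_trans (deg v); apply: subset_leq_card.
by apply/subsetP => e; rewrite !inE => /andP[/andP[-> _] ->].
Qed.

(** The weight [w x] is the share of the deleted edges charged to [x]. One cluster [B] is split off
    from [U], and induction treats [U :\: B]; each vertex pays once, when its cluster leaves. *)
Lemma greedy_partition (R : realType) (V W : finType) (T : sgraph W)
    (G : sgraph V) (w : V -> R) :
  vset G = [set: V] -> vset T != set0 ->
  {in vset T &, forall a b, connect (adj T) a b} ->
  (forall (U : {set V}) s, s \in U -> exists B : {set V},
     [/\ s \in B, B \subset U, minor_free T (induced G B)
       & #|boundary (induced G U) B|%:R <= \sum_(x in B) w x]) ->
  forall U : {set V}, exists H : sgraph V,
    [/\ vset H = U, eset H \subset eset (induced G U), minor_free T H
      & #|eset (induced G U) :\: eset H|%:R <= \sum_(x in U) w x].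
Proof.
move=> vG T0 conT cluster U; have [n] := ubnP #|U|.
elim: n U => // n IHn U; rewrite ltnS => leUn.
have [->|/set0Pn[s sU]] := eqVneq U set0.
  exists (induced G set0); split=> //; first by rewrite /= setI0.
    move=> /has_minor_card; rewrite /= setI0 cards0 leqn0 cards_eq0.
    exact/negP.
  by rewrite setDv cards0 big_set0.
have [B [sB sBU freeB leB]] := cluster U s sU.
have [|H [vH eH freeH leH]] := IHn (U :\: B).
  apply: leq_trans leUn; apply: proper_card; apply/properP.
  by split; [apply: subsetDl|exists s => //; rewrite inE sB].
have sUB e : e \in eset H -> e \subset U /\ e \subset ~: B.
  move=> /eset_wf[_]; rewrite vH => sub; split.
    exact: subset_trans sub (subsetDl _ _).
  by apply: subset_trans sub _; rewrite setDE subsetIr.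
pose es := eset (induced G B) :|: eset H.
have eK : eset (mkgraph U es) = es.
  apply: eset_mkgraph => e; rewrite inE eset_induced => /orP[/andP[eG eB]|eE].
    by have [-> _] := eset_wf eG; rewrite (subset_trans eB).
  by have [-> _] := eset_wf eE; have [-> _] := sUB e eE.
have meet (e A : {set V}) : #|e| = 2 -> e \subset A -> e \subset ~: A -> false.
  move=> e2 eA eA'; have : e \subset A :&: ~: A by rewrite subsetI eA.
  by rewrite setICr subset0 -cards_eq0 e2.
exists (mkgraph U es); split=> //.
- rewrite eK; apply/subsetP => e; rewrite inE !eset_induced.
  move=> /orP[/andP[-> eB]|eE]; first by rewrite (subset_trans eB).
  have := subsetP eH e eE; rewrite eset_induced => /andP[-> _].
  by have [-> _] := sUB e eE.
(* The new graph is the disjoint union of the cluster and [H], so a minor isomorphic to the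
   connected [T] would lie in one of them. *)
- have sep : separated (mkgraph U es) B.
    apply: separatedP => e; rewrite eK inE eset_induced.
    by move=> /orP[/andP[_ ->]//|/sUB[_ ->]]; rewrite orbT.
  have indB : induced (mkgraph U es) B = induced G B.
    apply: sgraph_eq; first by rewrite /= vG setTI (setIidPr sBU).
    apply/setP => e; rewrite [in LHS]eset_induced eK inE eset_induced.
    apply/andP/andP => [[/orP[/andP[-> ->]//|eE] eB]|[eG eB]].
      by have [e2 _] := eset_wf eE; have [_ /(meet _ B e2 eB)] := sUB e eE.
    by rewrite eG eB.
  have indC : induced (mkgraph U es) (~: B) = H.
    apply: sgraph_eq; first by rewrite /= vH setDE.
    apply/setP => e; rewrite eset_induced eK inE eset_induced.
    apply/andP/idP => [[/orP[/andP[eG eB] eB'|//]]|eE].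
      by have [e2 _] := eset_wf eG; have := meet _ B e2 eB eB'.
    by have [_ ->] := sUB e eE; rewrite eE orbT.
  by move=> /(separated_has_minor conT sep); rewrite indB indC => -[].
rewrite (big_setID B) (setIidPr sBU) [leRHS]/=.
(* A missing edge either crosses the boundary of [B] or lies inside [U :\: B] and was deleted by the
   induction. *)
apply: le_trans (lerD leB leH); rewrite -natrD ler_nat.
apply: leq_trans (leq_card_setU _ _); apply: subset_leq_card.
apply/subsetP => e; rewrite eK /es !in_setU !in_setD in_setU !eset_induced negb_or.
rewrite [e \in boundary _ _]in_set eset_induced.
move=> /andP[/andP[nB nH] /andP[eG eU]]; rewrite eG eU nH /= in nB *.
rewrite nB andbT subsetD eU /=.
by case: (boolP [disjoint e & B]) => //= ->.
Qed.

(** * Far graphs have many witnesses *)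

Section Tester.
Variables (R : realType) (W : finType) (T : sgraph W) (k d : nat) (eps : R).
Hypotheses (treeT : is_tree T) (cardT : #|vset T| = k).
Hypotheses (eps_gt0 : 0 < eps) (eps_le1 : eps <= 1).
Local Notation D := (bfs_depth k d eps).

(** Clusters are balls of the remaining graph, but the tester explores [G]; removing vertices only
    shrinks balls, so the cluster is still explored. *)
Lemma ball_minor_explored (V : finType) (G : sgraph V) (U : {set V}) n s :
  vset G = [set: V] -> (n < D)%N ->
  has_minor T (induced G (ball (induced G U) n s)) ->
  has_minor T (explored_subgraph G D s).
Proof.
move=> vG ltn; have [subv sube] := ball_explored G D s.
have sub := ball_induced G U n s.
apply: subgraph_has_minor.
  rewrite [vset (induced _ _)]/= vG setTI; apply: subset_trans sub _.
  exact: subset_trans (sub_ball _ _ (ltnW ltn)) subv.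
apply: subset_trans (sube n ltn); apply/subsetP => e; rewrite !eset_induced.
by move=> /andP[-> eB]; apply: subset_trans eB sub.
Qed.

Lemma sparse_cluster (V : finType) (G : sgraph V) (U : {set V}) s :
  vset G = [set: V] -> max_degree_le G d -> s \in U ->
  minor_free T (explored_subgraph G D s) ->
  exists B : {set V}, [/\ s \in B, B \subset U, minor_free T (induced G B)
    & #|boundary (induced G U) B|%:R <= eps / 2 * d%:R * #|B|%:R].
Proof.
(* For [d = 0] there are no edges, and the singleton of [s] serves. *)
move=> vG deg sU free; have [d0|d0] := posnP d.
  have eG e : e \notin eset G.
    apply/negP => eE; have [x [y [def_e _]]] := esetE eE.
    have := deg x; rewrite d0 leqn0 cards_eq0 => /eqP/setP/(_ e).
    by rewrite !inE eE def_e !inE eqxx.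
  exists [set s]; split; rewrite ?inE ?sub1set //.
    apply: contra_not free; apply: subgraph_has_minor.
      rewrite [vset (induced _ _)]/= vG setTI sub1set.
      by have [/subsetP subv _] := ball_explored G D s; apply/subv/ball_center.
    by apply/subsetP => e; rewrite eset_induced (negPf (eG e)).
  have -> : boundary (induced G U) [set s] = set0.
    by apply/setP => e; rewrite in_set0 inE eset_induced (negPf (eG e)).
  by rewrite cards0 !mulr_ge0 ?invr_ge0 // ltW.
have k0 : (0 < k)%N by rewrite -cardT card_gt0; case: treeT.
have [n ltnD ltn] := growth_beats_tree_size k0 d0 eps_gt0 eps_le1.
set K := induced G U; have degK : max_degree_le K d by apply: max_degree_induced.
have sK : s \in vset K by rewrite /= vG setTI.
have subU i : ball K i s \subset U.
  by have := ball_vset i sK; rewrite /= vG setTI.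
have [i lti sparse] : exists2 i, (i < n)%N &
    #|boundary K (ball K i s)|%:R <= eps / 2 * d%:R * #|ball K i s|%:R.
  (* If all balls of radius below [n] were dense, the ball of radius [n] would be large enough to
     contain the minor, and the search from [s] would have found it. *)
  apply: contrapT => dense; apply: free.
  apply: (@ball_minor_explored V G U n) => //.
  rewrite -(induced_induced _ (subU n)) -/K.
  apply: (large_ball_has_minor (d := d) (j := k)) => //; first by rewrite cardT.
  rewrite -(ltr_nat R); apply: lt_le_trans ltn _; apply: (ball_growth (d := d)) => //.
    by rewrite divr_ge0 // ltW.
  move=> i lti; rewrite ltNge; apply/negP => le; apply: dense.
  by exists i.
exists (ball K i s); split=> //; first exact: ball_center.
by apply: contra_not free; apply: ball_minor_explored => //; apply: ltn_trans ltnD.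
Qed.

Definition witnesses (V : finType) (G : sgraph V) : {set V} :=
  [set s | `[< has_minor T (explored_subgraph G D s) >]].

Lemma many_witnesses N (G : sgraph 'I_N) :
  vset G = [set: 'I_N] -> max_degree_le G d -> far_from_minor_free T d eps G ->
  eps / 2 * N%:R < #|witnesses G|%:R.
Proof.
move=> vG deg far; have [T0 conT _] := treeT.
(* Isolating a vertex does not destroy a one-vertex [T]. In that case every vertex is a witness, and
   [N > 0] because the empty graph is not far. *)
have [k1|k2] := leqP k 1.
  have N0 : (0 < N)%N.
    rewrite lt0n; apply/eqP => N0.
    have free : minor_free T G.
      move=> /has_minor_card; rewrite vG cardsT card_ord N0 leqn0 cards_eq0.
      exact/negP.
    have := far G vG free.
    by rewrite /edge_symdiff setDv setU0 cards0 N0 mulr0 ltxx.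
  have -> : witnesses G = [set: 'I_N].
    apply/setP => s; rewrite !inE; apply/asboolP.
    have [t tT] := set0Pn _ T0.
    have defT : vset T = [set t].
      by apply/esym/eqP; rewrite eqEcard sub1set tT cards1 cardT.
    apply: (model_has_minor T0); rewrite defT; apply: (model_single _ _ _ (x := s)).
    by have [/subsetP subv _] := ball_explored G D s; apply/subv/ball_center.
  by rewrite cardsT card_ord; have : 0 < N%:R :> R; [rewrite ltr0n|have := eps_le1; nra].
rewrite ltNge; apply/negP => few.
(* Every vertex pays its share of a sparse boundary, and a witness pays [d] more for its own
   isolation. With at most [eps N / 2] witnesses, the total is at most [eps d N]. *)
pose w s : R := eps / 2 * d%:R + (s \in witnesses G)%:R * d%:R.
have sumw (B : {set 'I_N}) :
    \sum_(x in B) w x = eps / 2 * d%:R * #|B|%:R + d%:R * #|B :&: witnesses G|%:R.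
  rewrite big_split /= sumr_const -[_ *+ #|B|]mulr_natr -mulr_suml -natr_sum.
  rewrite [X in _ + X]mulrC.
  congr (_ + d%:R * _%:R); rewrite -sum1_card big_mkcond /= [RHS]big_mkcond /=.
  by apply: eq_bigr => x _; rewrite !inE; case: (x \in B); case: asbool.
have cluster (U : {set 'I_N}) s : s \in U -> exists B : {set 'I_N},
   [/\ s \in B, B \subset U, minor_free T (induced G B)
     & #|boundary (induced G U) B|%:R <= \sum_(x in B) w x].
  move=> sU; have [bad|good] := boolP (s \in witnesses G).
    exists [set s]; rewrite inE sub1set; split=> //.
      move=> /has_minor_card; rewrite /= vG setTI cards1 cardT.
      by rewrite leqNgt k2.
    have -> : \sum_(x in [set s]) w x = w s by rewrite big_set1.
    rewrite /w bad mul1r; apply: (@le_trans _ _ d%:R); last first.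
      by rewrite lerDr mulr_ge0 // divr_ge0 // ltW.
    have := card_edges_meeting [set s] (max_degree_induced U deg).
    rewrite cards1 muln1 => le_d; rewrite ler_nat; apply: leq_trans le_d.
    by apply: subset_leq_card; apply/subsetP => e; rewrite !in_set => /and3P[-> ->].
  have free : minor_free T (explored_subgraph G D s).
    by move=> m; move: good; rewrite inE => /negP; apply; apply/asboolP.
  have [B [sB sBU freeB leB]] := sparse_cluster vG deg sU free.
  by exists B; split=> //; apply: le_trans leB _; rewrite sumw lerDl mulr_ge0.
have [H [vH eH freeH leH]] := greedy_partition vG T0 conT cluster [set: 'I_N].
have := far H vH freeH; rewrite (induced_id (subsetT _)) in eH leH.
have -> : edge_symdiff G H = eset G :\: eset H.
  by rewrite /edge_symdiff; move: eH; rewrite -setD_eq0 => /eqP->; rewrite setU0.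
rewrite ltNge => /negP; apply; apply: le_trans leH _.
rewrite sumw setTI cardsT card_ord.
have : d%:R * #|witnesses G|%:R <= d%:R * (eps / 2 * N%:R) by rewrite ler_wpM2l.
by move=> ?; lra.
Qed.

End Tester.

(** * The rejection probability *)

(** With density [p = #|A| / N], all samples miss [A] with probability [(1 - p) ^ m]. Since
    [(1 - p)(1 + p) <= 1] and [(1 + p) ^ m >= 1 + m p >= 3], this is at most [1 / 3]. *)
Lemma hitting_probability (R : realType) (N m : nat) (A : {set 'I_N}) (eps : R) :
  0 < eps -> 4 / eps <= m%:R -> eps / 2 * N%:R < #|A|%:R ->
  2 / 3 <= uniform_Pr R (fun f : {ffun 'I_m -> 'I_N} => exists i, f i \in A).
Proof.
move=> e0 lem ltA; rewrite /uniform_Pr.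
set hit := [set f | _].
have N0 : 0 < N%:R :> R.
  have leA : #|A|%:R <= N%:R :> R by rewrite ler_nat -[leqRHS]card_ord max_card.
  rewrite lt_neqAle ler0n andbT; apply/eqP => N0.
  by move: (lt_le_trans ltA leA); rewrite -N0 mulr0 ltxx.
have cardC : #|~: hit| = (#|~: A| ^ m)%N.
  rewrite -[in RHS](card_ord m) -card_ffun_on; apply: eq_card => f.
  rewrite !inE; apply/negP/ffun_onP => [no i|all].
    by rewrite inE; apply/negP => fi; apply: no; apply/asboolP; exists i.
  by move=> /asboolP[i fi]; have := all i; rewrite inE fi.
have cardT : #|{ffun 'I_m -> 'I_N}| = (N ^ m)%N by rewrite card_ffun !card_ord.
have cardA : #|A|%:R + #|~: A|%:R = N%:R :> R by rewrite -natrD cardsC card_ord.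
have cardH : #|hit|%:R + #|~: A|%:R ^+ m = N%:R ^+ m :> R.
  by rewrite -!natrX -cardC -natrD cardsC cardT.
rewrite cardT natrX ler_pdivlMr ?exprn_gt0 //.
set p := #|A|%:R / N%:R : R.
have pN : p * N%:R = #|A|%:R by rewrite divfK // gt_eqF.
have p0 : 0 <= p by rewrite divr_ge0 // ltW.
have ltp : eps / 2 < p by rewrite -(ltr_pM2r N0) pN.
have mp : 2 <= m%:R * p.
  have : 4 <= m%:R * eps by rewrite -ler_pdivrMr.
  have : m%:R * (eps / 2) <= m%:R * p by rewrite ler_wpM2l // ltW.
  lra.
have big3 : 3 <= (1 + p) ^+ m by apply: le_trans (bernoulli m p0); lra.
have leC : (1 + p) ^+ m * #|~: A|%:R ^+ m <= N%:R ^+ m.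
  rewrite -exprMn lerXn2r ?nnegrE ?mulr_ge0 //; try lra.
  have -> : #|~: A|%:R = (1 - p) * N%:R :> R by rewrite mulrBl pN; lra.
  have := mulr_ge0 (mulr_ge0 p0 p0) (ltW N0).
  lra.
have : 3 * #|~: A|%:R ^+ m <= (1 + p) ^+ m * #|~: A|%:R ^+ m.
  by rewrite ler_wpM2r // exprn_ge0.
lra.
Qed.

Theorem theorem7p7 (R : realType) :
  exists eps0 : R, 0 < eps0 /\
  forall (VT : finType) (T : sgraph VT) (k d : nat),
    is_tree T -> #|vset T| = k ->
  forall eps : R, 0 < eps -> eps <= eps0 ->
  forall (N : nat) (G : sgraph 'I_N),
    vset G = [set: 'I_N] -> max_degree_le G d ->
    far_from_minor_free T d eps G ->
    2 / 3 <=
      uniform_Pr R (fun start : {ffun 'I_(num_starts eps) -> 'I_N} =>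
        ~ tester_accepts T (bfs_depth k d eps) G start).
Proof.
(* The bound [eps <= 1] gives [8 d / eps >= 8 d] in the growth estimate and [eps N / 2 < N] for a
   one-vertex tree. *)
exists 1; split=> // VT T k d treeT cardT eps e0 e1 N G vG deg far.
have many := many_witnesses treeT cardT e0 e1 vG deg far.
have le_m : 4 / eps <= (num_starts eps)%:R.
  by have /andP[] : 4 / eps <= (num_starts eps)%:R < 4 / eps + 1
    by apply: ceil_nat_itv; rewrite divr_ge0 // ltW.
apply: le_trans (hitting_probability e0 le_m many) _.
rewrite /uniform_Pr ler_wpM2r ?invr_ge0 // ler_nat; apply: subset_leq_card.
apply/subsetP => f; rewrite !inE => /asboolP[i]; rewrite inE => /asboolP fi.
by apply/asboolP => acc; apply: (acc i).
Qed.
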